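(* Let $G$ be a simple graph on the vertex set $[n]=\{1,\dots,n\}$ with no isolated vertices, and let $I=I(G)\subset S=K[x_1,\dots,x_n]$ be its edge ideal. Then the squarefree power $I^{[\nu(G)]}$ has linear quotients.
   Context: $K$ is a field and $S=K[x_1,\dots,x_n]$. The edge ideal of a simple graph $G$ on $[n]$ is the ideal of $S$ generated by the monomials $x_ix_j$ with $\{i,j\}\in E(G)$. For a monomial ideal $J$, $G(J)$ denotes its unique minimal set of monomial generators. For a squarefree monomial ideal $I$, the $k$-th squarefree power $I^{[k]}$ is the monomial ideal generated by all squarefree monomials in $G(I^k)$. For an edge ideal, the generators of $I^{[k]}$ correspond to the vertex sets of matchings of $G$ of size $k$. A matching of $G$ is a set of edges of $G$ no two of which share a vertex; the matching number $\nu(G)$ is the maximal size of a matching of $G$. A monomial ideal $J$ has linear quotients if its minimal monomial generators can be ordered $u_1,\dots,u_t$ such that for each $2\le i\le t$ the colon ideal $(u_1,\dots,u_{i-1}):u_i$ is generated by variables. *)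

(* Defs.v *)
From mathcomp Require Import all_boot all_order all_algebra.
From mathcomp Require Import mpoly.
Set Implicit Arguments.
Unset Strict Implicit.
Unset Printing Implicit Defensive.

Import GRing.Theory.
Local Open Scope ring_scope.

(* Ideals of S = K[x_1, ..., x_n] are Prop-valued predicates on {mpoly K[n]},
   since membership need not be decidable; they are compared extensionally.
   The vertex i + 1 of [n] is the ordinal i : 'I_n. *)

Section Ideals.
Variables (K : fieldType) (n : nat).
Implicit Types (P I J : {mpoly K[n]} -> Prop) (A B : 'X_{1..n} -> Prop).

Definition ideal_gen P : {mpoly K[n]} -> Prop := fun f =>
  exists2 s : seq ({mpoly K[n]} * {mpoly K[n]}),
    (forall x, x \in s -> P x.2) & f = \sum_(x <- s) x.1 * x.2.

Definition ideal_eq I J : Prop := forall f, I f <-> J f.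

Definition ideal_mul I J : {mpoly K[n]} -> Prop :=
  ideal_gen (fun h => exists f g, [/\ I f, J g & h = f * g]).

Fixpoint ideal_pow I (k : nat) : {mpoly K[n]} -> Prop :=
  if k is k'.+1 then ideal_mul I (ideal_pow I k') else fun=> True.

Definition colon I (f : {mpoly K[n]}) : {mpoly K[n]} -> Prop :=
  fun g => I (g * f).

(* A monomial is represented by its exponent vector m : 'X_{1..n}. *)
Definition monomial_ideal A : {mpoly K[n]} -> Prop :=
  ideal_gen (fun f => exists2 m, A m & f = 'X_[m]).

Definition min_monomial_gens J A : Prop :=
  ideal_eq J (monomial_ideal A) /\
  forall B, (forall m, B m -> A m) -> ideal_eq J (monomial_ideal B) ->
    forall m, A m -> B m.

(* G(J), for a monomial ideal J.  Such a J has exactly one minimal set of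
   monomial generators, so the existential only names that set. *)
Definition mingens J : 'X_{1..n} -> Prop :=
  fun m => exists2 A, min_monomial_gens J A & A m.

Definition squarefree (m : 'X_{1..n}) : bool := [forall i, m i <= 1]%N.

Definition squarefree_power I (k : nat) : {mpoly K[n]} -> Prop :=
  monomial_ideal (fun m => squarefree m /\ mingens (ideal_pow I k) m).

(* The zero ideal has linear quotients, with the empty sequence u.
   The indices are shifted: nth 0%MM u i is u_{i+1}. *)
Definition has_linear_quotients J : Prop :=
  exists u : seq 'X_{1..n},
    [/\ uniq u,
        min_monomial_gens J (fun m => m \in u) &
        forall i, (0 < i < size u)%N ->
          exists V : {set 'I_n},
            ideal_eq
              (colon (monomial_ideal (fun m => m \in take i u))
                     'X_[nth 0%MM u i])
              (ideal_gen (fun f => exists2 v, v \in V & f = 'X_v))].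

End Ideals.

Section Graphs.
Variables (n : nat) (e : rel 'I_n).

Definition no_isolated_vertices : Prop := forall i, exists j, e i j.

Definition edge_set : {set {set 'I_n}} :=
  [set [set p.1; p.2] | p : 'I_n * 'I_n & e p.1 p.2].

Definition matching (M : {set {set 'I_n}}) : bool :=
  (M \subset edge_set) && trivIset M.

Definition matching_number : nat :=
  \max_(M : {set {set 'I_n}} | matching M) #|M|.

Definition edge_ideal (K : fieldType) : {mpoly K[n]} -> Prop :=
  ideal_gen (fun f => exists i j, e i j /\ f = 'X_i * 'X_j).

End Graphs.

Arguments edge_ideal {n} e K _.

(* Main.v *)
(** The minimal generators of the squarefree power are the squarefree monomials
    supported on the vertex sets of maximum matchings, all of the same degree.
    These vertex sets satisfy the exchange property of the bases of a matroid:
    if [v] is covered by the maximum matching [N] but not by the maximum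
    matching [M], follow the alternating walk from [v]; since neither matching
    can be augmented, it ends at a vertex [a] covered by [M] only, and switching
    [M] along it replaces [a] by [v].  Now order the generators decreasingly for
    the lexicographic order.  If the generator [x_W] precedes [x_U], let [v] be
    the first vertex at which [U] and [W] differ: it lies in [W], and exchanging
    it with some [a] of [U] outside [W] yields a generator that precedes [x_U]
    and divides [x_v x_U], so that [x_v] lies in the colon ideal and divides
    [x_W / gcd(x_W, x_U)]. *)

Require Import Defs.
From mathcomp Require Import all_boot all_order all_algebra.
From mathcomp Require Import mpoly.
Set Implicit Arguments.
Unset Strict Implicit.
Unset Printing Implicit Defensive.

Import Order.TTheory GRing.Theory.
Local Open Scope ring_scope.

(** * Monomial ideals and their minimal generators *)

Section MonomialIdeals.
Variables (K : fieldType) (n : nat).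
Implicit Types (P Q I J : {mpoly K[n]} -> Prop) (A B : 'X_{1..n} -> Prop).
Implicit Types (f g : {mpoly K[n]}) (m : 'X_{1..n}).

Lemma ideal_gen0 P : ideal_gen P 0.
Proof. by exists [::] => //; rewrite big_nil. Qed.

Lemma ideal_genD P f g : ideal_gen P f -> ideal_gen P g -> ideal_gen P (f + g).
Proof.
move=> [s Ps ->] [t Pt ->]; exists (s ++ t); last by rewrite big_cat.
by move=> x; rewrite mem_cat => /orP[/Ps|/Pt].
Qed.

Lemma ideal_gen_incl P f : P f -> ideal_gen P f.
Proof.
move=> Pf; exists [:: (1, f)]; last by rewrite big_seq1 mul1r.
by move=> x; rewrite inE => /eqP ->.
Qed.

Lemma ideal_genM P f g : ideal_gen P g -> ideal_gen P (f * g).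
Proof.
move=> [s Ps ->]; exists [seq (f * x.1, x.2) | x <- s].
  by move=> _ /mapP[x xs ->]; exact: Ps x xs.
by rewrite big_map mulr_sumr; apply: eq_bigr => x _; rewrite /= mulrA.
Qed.

Lemma ideal_gen_sub P Q :
  (forall f, P f -> ideal_gen Q f) -> forall f, ideal_gen P f -> ideal_gen Q f.
Proof.
move=> PQ f [s Ps ->]; elim: s Ps => [|x s IHs] Ps.
  by rewrite big_nil; apply: ideal_gen0.
rewrite big_cons; apply: ideal_genD.
  by apply/ideal_genM/PQ/Ps; rewrite mem_head.
by apply: IHs => y ys; apply: Ps; rewrite inE ys orbT.
Qed.

(** Multiplying by a monomial shifts the support, so each term of a combination of generators is a
    multiple of one of them; conversely, a polynomial is the sum of its terms. Membership questions
    thus become divisibility questions on exponent vectors. *)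
Lemma monomial_idealP A f :
  monomial_ideal A f <->
  (forall m, m \in msupp f -> exists2 a, A a & (a <= m)%MM).
Proof.
split=> [[s As ->]|Af]; last first.
  rewrite [f]mpolyE big_seq.
  apply: (big_ind (ideal_gen _)); [exact: ideal_gen0|exact: ideal_genD|].
  move=> m /Af[a Aa le_am]; rewrite -mul_mpolyC; apply: ideal_genM.
  rewrite -(submK le_am) mpolyXD; apply/ideal_genM/ideal_gen_incl.
  by exists a.
elim: s As => [|x s IHs] As m; first by rewrite big_nil msupp0.
rewrite big_cons => /msuppD_le; rewrite mem_cat => /orP[|m_s]; last first.
  by apply: IHs m_s => y ys; apply: As; rewrite inE ys orbT.
have [a Aa ->] := As x (mem_head _ _).
rewrite (perm_mem (msuppMX _ _)) => /mapP[m' _ ->].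
by exists a => //; apply: lem_addr.
Qed.

Lemma monomial_ideal_mono A B :
  (forall m, A m -> B m) ->
  forall f, monomial_ideal A f -> monomial_ideal B f.
Proof.
move=> AB f /monomial_idealP Af; apply/monomial_idealP => m /Af[a /AB Ba le_am].
by exists a.
Qed.

Lemma monomial_idealX A m :
  monomial_ideal A 'X_[K, m] <-> exists2 a, A a & (a <= m)%MM.
Proof.
split=> [/monomial_idealP|[a Aa le_am]]; first by apply; rewrite msuppX mem_head.
by apply/monomial_idealP => m'; rewrite msuppX inE => /eqP ->; exists a.
Qed.

Lemma monomial_ideal_mul I J A B :
  ideal_eq I (monomial_ideal A) -> ideal_eq J (monomial_ideal B) ->
  ideal_eq (ideal_mul I J)
    (monomial_ideal (fun m => exists a b, [/\ A a, B b & m = (a + b)%MM])).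
Proof.
move=> eqI eqJ f; split; apply: ideal_gen_sub => {}f.
  move=> [g [h [/eqI/monomial_idealP Ag /eqJ/monomial_idealP Bh ->]]].
  apply/monomial_idealP => m /msuppM_le/allpairsP[[m1 m2]] /=.
  case=> /Ag[a Aa le_a] /Bh[b Bb le_b] ->.
  exists (a + b)%MM; first by exists a, b.
  apply/mnm_lepP => i; rewrite !mnmDE.
  by apply: leq_add; [apply: (mnm_lepP le_a)|apply: (mnm_lepP le_b)].
move=> [_ [a [b [Aa Bb ->]]] ->]; apply: ideal_gen_incl.
exists 'X_[a], 'X_[b]; split; last by rewrite mpolyXD.
  by apply/eqI/monomial_idealX; exists a => //; apply: lepm_refl.
by apply/eqJ/monomial_idealX; exists b => //; apply: lepm_refl.
Qed.

Lemma mdeg_lepm_eq m m' : (m <= m')%MM -> mdeg m = mdeg m' -> m = m'.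
Proof.
move=> /submK <-; rewrite mdegD => /eqP.
by rewrite -{1}[mdeg m]add0n eqn_add2r eq_sym mdeg_eq0 => /eqP ->; rewrite add0m.
Qed.

Section Equigenerated.
Variables (A : 'X_{1..n} -> Prop) (d : nat).
Hypothesis A_deg : forall m, A m -> mdeg m = d.

(** Each [m] in [A] is divisible by some [b] in [B], itself divisible by some [a] in [A]. Equality
    of degrees forces [a = m], hence [b = m]. *)
Lemma equigenerated_min B :
  ideal_eq (monomial_ideal (K := K) A) (monomial_ideal B) ->
  forall m, A m -> B m.
Proof.
move=> eqAB m Am.
have /monomial_idealX[b Bb le_bm] : monomial_ideal B 'X_[K, m].
  by apply/eqAB/monomial_idealX; exists m => //; apply: lepm_refl.
have /monomial_idealX[a Aa le_ab] : monomial_ideal A 'X_[K, b].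
  by apply/eqAB/monomial_idealX; exists b => //; apply: lepm_refl.
have eq_am : a = m.
  by apply: mdeg_lepm_eq (lepm_trans le_ab le_bm) _; rewrite !A_deg.
suff <- : b = m by [].
apply/mnmP => i; apply/eqP.
by rewrite eqn_leq (mnm_lepP le_bm) -{1}eq_am (mnm_lepP le_ab).
Qed.

Lemma min_monomial_gens_equigenerated J :
  ideal_eq J (monomial_ideal A) -> min_monomial_gens J A.
Proof.
move=> eqJ; split=> // B _ eqJB; apply: equigenerated_min => f.
by rewrite -(eqJ f) -(eqJB f).
Qed.

Lemma mingens_equigenerated J m :
  ideal_eq J (monomial_ideal A) -> mingens J m <-> A m.
Proof.
move=> eqJ; split=> [[C [eqJC minC] Cm]|Am]; last first.
  by exists A => //; apply: min_monomial_gens_equigenerated.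
have AC : forall m, A m -> C m.
  by apply: equigenerated_min => f; rewrite -(eqJ f) -(eqJC f).
exact: minC AC eqJ m Cm.
Qed.

End Equigenerated.

End MonomialIdeals.

(** * Matchings and the exchange property *)

Section Matchings.
Variables (n : nat) (e : rel 'I_n).
Hypotheses (e_sym : ssrbool.symmetric e) (e_irr : irreflexive e).
Implicit Types (M N : {set {set 'I_n}}) (U : {set 'I_n}) (x y v w : 'I_n).

Lemma edge_setP E :
  reflect (exists x y, e x y /\ E = [set x; y]) (E \in edge_set e).
Proof.
apply: (iffP imsetP) => [[[x y] /=]|[x [y [exy ->]]]].
  by rewrite inE => exy ->; exists x, y.
by exists (x, y); rewrite ?inE.
Qed.

Lemma edge_neq x y : e x y -> x != y.
Proof. by apply: contraTneq => ->; rewrite e_irr. Qed.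

Lemma edge_at E x :
  E \in edge_set e -> x \in E -> exists2 y, e x y & E = [set x; y].
Proof.
move=> /edge_setP[a [b [eab ->]]]; rewrite !inE => /orP[]/eqP->; first by exists b.
by exists a; rewrite 1?e_sym // setUC.
Qed.

Lemma matching_cover M x :
  matching e M -> x \in cover M -> exists2 y, e x y & [set x; y] \in M.
Proof.
case/andP=> /subsetP sME _ /bigcupP[E EM /(edge_at (sME _ EM))[y exy defE]].
by exists y; rewrite -?defE.
Qed.

Lemma matching_le M : matching e M -> (#|M| <= matching_number e)%N.
Proof. exact: leq_bigmax_cond. Qed.

Lemma matching_sub M N : M \subset N -> matching e N -> matching e M.
Proof.
move=> sMN /andP[sNE trN]; apply/andP; split; first exact: subset_trans sNE.
exact: trivIsetS trN.
Qed.

Lemma matching_add M x y :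
  matching e M -> e x y -> x \notin cover M -> y \notin cover M ->
  [/\ matching e ([set x; y] |: M), #|[set x; y] |: M| = #|M|.+1
    & cover ([set x; y] |: M) = [set x; y] :|: cover M].
Proof.
move=> /andP[sME trM] exy xM yM.
have nE : [set x; y] \notin M.
  apply: contra xM => EM; apply/bigcupP; exists [set x; y] => //.
  by rewrite set21.
have cE : cover ([set x; y] |: M) = [set x; y] :|: cover M.
  by rewrite /cover big_setU1.
split=> //; last by rewrite cardsU1 nE.
apply/andP; split.
  rewrite subUset sME andbT sub1set.
  by apply/edge_setP; exists x, y.
rewrite setUC; apply: trivIsetU => //; first exact: trivIset1.
rewrite cover1 disjoint_sym -setI_eq0; apply/eqP/setP => z; rewrite !inE.
by apply/andP => -[/orP[]/eqP-> zM]; move: xM yM; rewrite zM.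
Qed.

(** One step of the alternating walk: [w] changes partner from [w'] to [v] and stays covered, so
    only [w'] is released. *)
Lemma matching_swap M v w w' :
  matching e M -> v \notin cover M -> [set w; w'] \in M -> e v w -> w != w' ->
  let M' := [set v; w] |: (M :\ [set w; w']) in
  [/\ matching e M', #|M'| = #|M| & cover M' = v |: (cover M :\ w')].
Proof.
move=> mM vM EM evw ne_ww'; have /andP[_ trM] := mM.
have cD := coverD1 trM EM.
have v_ncov : v \notin cover (M :\ [set w; w']).
  by rewrite cD inE (negbTE vM) andbF.
have w_ncov : w \notin cover (M :\ [set w; w']) by rewrite cD !inE eqxx.
rewrite /=; have [mM' cardM' ->] :=
  matching_add (matching_sub (subD1set _ _) mM) evw v_ncov w_ncov.
split=> //; first by rewrite cardM' [RHS](cardsD1 [set w; w']) EM.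
have wM : w \in cover M by apply/bigcupP; exists [set w; w']; rewrite ?set21.
rewrite cD; apply/setP => z; rewrite !inE.
have [->|_] := eqVneq z w; first by rewrite wM ne_ww' !orbT.
by rewrite orbF.
Qed.

Definition matched k U :=
  [exists M, [&& matching e M, #|M| == k & cover M == U]].

Lemma matchedP k U :
  reflect (exists M, [/\ matching e M, #|M| = k & cover M = U]) (matched k U).
Proof.
apply: (iffP existsP) => -[M].
  by case/and3P=> mM /eqP kM /eqP cM; exists M.
by case=> mM kM cM; exists M; rewrite mM kM cM !eqxx.
Qed.

(* The alternating walk starting at [v] is followed two edges at a time: when
   the walk does not end, the first two edges are swapped in [M], which brings
   [M] closer to [N] and moves the starting point from [v] to [w']. *)
Lemma matching_exchange M N v :
  matching e M -> matching e N -> #|M| = matching_number e ->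
  v \in cover N -> v \notin cover M ->
  exists a, [/\ a \in cover M, a \notin cover N
              & matched (matching_number e) (v |: (cover M :\ a))].
Proof.
move=> mM mN; have [r] := ubnP #|N :\: M|.
elim: r => // r IHr in M v mM * => lt_r maxM vN vM.
have [w evw EN] := matching_cover mN vN.
(* Otherwise the edge between [v] and [w] would augment the maximum matching [M]. *)
have wM : w \in cover M.
  apply/negPn/negP => wM; have [/matching_le + kM _] := matching_add mM evw vM wM.
  by rewrite kM maxM ltnn.
have [w' eww' EM] := matching_cover mM wM.
have ne_ww' := edge_neq eww'.
have w'M : w' \in cover M by apply/bigcupP; exists [set w; w']; rewrite ?set22.
have ne_vw' : v != w' by apply: contraNneq vM => ->.
have [] := matching_swap mM vM EM evw ne_ww'.
set M' := _ |: _ => mM' kM' cM'.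
(* If [N] misses [w'], the walk ends there and [a] is [w']. *)
have [w'N|w'N] := boolP (w' \in cover N); last first.
  by exists w'; split=> //; apply/matchedP; exists M'; rewrite kM'.
have w'M' : w' \notin cover M' by rewrite cM' !inE eqxx eq_sym (negbTE ne_vw').
have EnN : [set w; w'] \notin N.
  apply/negP => E'N; have /andP[_ /trivIsetP trN] := mN.
  have ne_E : [set v; w] != [set w; w'].
    apply/eqP => /setP/(_ v).
    by rewrite !inE eqxx (negbTE ne_vw') (negbTE (edge_neq evw)).
  have := trN _ _ EN E'N ne_E.
  by rewrite -setI_eq0 => /eqP/setP/(_ w); rewrite !inE eqxx orbT.
have EnM : [set v; w] \notin M.
  by apply: contra vM => E; apply/bigcupP; exists [set v; w]; rewrite ?set21.
(* The swap gains the edge [[set v; w]] of [N]; the edge it drops is not in [N], which already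
   matches [w] with [v]. *)
have lt_r' : (#|N :\: M'| < r)%N.
  rewrite -ltnS; apply: leq_trans lt_r; rewrite ltnS; apply/proper_card/properP; split.
    apply/subsetP => E; rewrite !inE !negb_or !negb_and negbK.
    by case/andP=> /andP[_ /orP[/eqP->|->//]]; rewrite (negbTE EnN).
  by exists [set v; w]; rewrite !inE ?EN ?EnM ?eqxx.
have [|a [aM' aN]] := IHr M' w' mM' lt_r' _ w'N w'M'; first by rewrite kM'.
have ne_av : a != v by apply: contraNneq aN => ->.
have ne_aw' : a != w' by apply: contraNneq aN => ->.
move: aM'; rewrite cM' !inE (negbTE ne_av) ne_aw' /= => aM.
(* The swap trades [w'] for [v] and the rest of the walk trades [a] for [w'], so the net effect is
   to trade [a] for [v]. *)
have -> : w' |: ((v |: (cover M :\ w')) :\ a) = v |: (cover M :\ a).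
  apply/setP => z; rewrite !inE.
  have [->|] := eqVneq z w'; first by rewrite w'M eq_sym ne_aw' orbT.
  have [->|] := eqVneq z v; first by rewrite [v == a]eq_sym ne_av.
  by rewrite andbCA.
by exists a.
Qed.

Lemma matched_exchange U W v :
  matched (matching_number e) U -> matched (matching_number e) W ->
  v \in W -> v \notin U ->
  exists a, [/\ a \in U, a \notin W
              & matched (matching_number e) (v |: (U :\ a))].
Proof.
by move=> /matchedP[M [mM kM <-]] /matchedP[N [mN _ <-]]; apply: matching_exchange.
Qed.

(** * Products of [k] edges, repetitions allowed, and the squarefree ones among them *)

Fixpoint edge_sum (k : nat) (m : 'X_{1..n}) : Prop :=
  if k is k'.+1 then
    exists i j m', [/\ e i j, edge_sum k' m' & m = (U_(i) + U_(j) + m')%MM]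
  else m = 0%MM.

Lemma edge_sum_mdeg k m : edge_sum k m -> mdeg m = k.*2.
Proof.
elim: k m => [|k IHk] m /=; first by move->; rewrite mdeg0.
by case=> i [j [m' [_ /IHk m'k ->]]]; rewrite !mdegD !mdeg1 m'k.
Qed.

Lemma ideal_pow_edge (K : fieldType) k :
  ideal_eq (ideal_pow (edge_ideal e K) k) (monomial_ideal (edge_sum k)).
Proof.
elim: k => [|k IHk].
  (* The zeroth power is the whole ring, generated by the monomial 1. *)
  move=> f; split=> // _; apply/monomial_idealP => m _; exists 0%MM => //.
  by apply/mnm_lepP => i; rewrite mnm0E.
have eqI : ideal_eq (edge_ideal e K)
    (monomial_ideal (fun m => exists i j, e i j /\ m = (U_(i) + U_(j))%MM)).
  move=> f; split; apply: ideal_gen_sub => {}f.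
    case=> i [j [eij ->]]; rewrite -mpolyXD; apply/ideal_gen_incl.
    by exists (U_(i) + U_(j))%MM => //; exists i, j.
  case=> _ [i [j [eij ->]]] ->; apply/ideal_gen_incl; exists i, j.
  by rewrite mpolyXD.
move=> f; rewrite /= (monomial_ideal_mul eqI IHk f).
split; apply: monomial_ideal_mono => m.
  by case=> _ [b [[i [j [eij ->]]] kb ->]]; exists i, j, b.
case=> i [j [m' [eij km' ->]]]; exists (U_(i) + U_(j))%MM, m'; split=> //.
by exists i, j.
Qed.

Lemma mesym1_mem U i : mesym1 U i = (i \in U) :> nat.
Proof. exact: mnmE. Qed.

Lemma squarefree_mesym1 U : squarefree (mesym1 U).
Proof. by apply/forallP => i; rewrite mesym1_mem leq_b1. Qed.

Lemma mesym1_edge x y U : x != y -> x \notin U -> y \notin U ->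
  mesym1 ([set x; y] :|: U) = (U_(x) + U_(y) + mesym1 U)%MM.
Proof.
move=> ne_xy xU yU; apply/mnmP => i; rewrite !mnmDE !mesym1_mem !mnm1E !inE.
rewrite ![i == _]eq_sym; case: eqVneq => [<-|_] /=.
  by rewrite eq_sym (negbTE ne_xy) (negbTE xU).
by case: eqVneq => [<-|_] //=; rewrite (negbTE yU).
Qed.

(** When all exponents are at most 1, each edge of the product avoids the vertices of the others, so
    the edges form a matching. Conversely, a matching is peeled off edge by edge. *)
Lemma squarefree_edge_sum k m :
  squarefree m /\ edge_sum k m <-> exists2 U, matched k U & m = mesym1 U.
Proof.
split=> [|[U /matchedP[M [mM kM <-]]] ->]; last first.
  split; first exact: squarefree_mesym1.
  elim: k M mM kM => [|k IHk] M mM kM /=.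
    by rewrite (cards0_eq kM) /cover big_set0 mesym1_set0.
  have /card_gt0P[E EM] : (0 < #|M|)%N by rewrite kM.
  have /andP[/subsetP sME trM] := mM.
  have /edge_setP[x [y [exy defE]]] := sME E EM.
  exists x, y, (mesym1 (cover (M :\ E))); split=> //.
    apply: IHk; first exact: matching_sub (subD1set _ _) mM.
    by move: kM; rewrite (cardsD1 E) EM => -[].
  rewrite -mesym1_edge ?edge_neq // coverD1 // defE ?inE ?eqxx ?orbT //.
  by rewrite -defE setDE setUIr setUCr setIT (setUidPr _) // bigcup_sup.
elim: k m => [|k IHk] m [sq_m /=].
  move=> ->; exists set0; rewrite ?mesym1_set0 //; apply/matchedP.
  exists set0; rewrite cards0 /cover big_set0; split=> //; apply/andP.
  by split; [exact: sub0set|apply/trivIsetP => A B; rewrite inE].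
case=> x [y [m' [exy km' def_m]]].
have le1 i : (m i <= 1)%N by apply: (forallP sq_m).
have [|U /matchedP[M [mM kM <-]] def_m'] := IHk m'.
  split=> //; apply/forallP => i; apply: leq_trans (le1 i).
  by rewrite def_m mnmDE leq_addl.
have ne_xy := edge_neq exy.
have xM : x \notin cover M.
  move: (le1 x); rewrite def_m def_m' !mnmDE !mnm1E eqxx mesym1_mem.
  by case: (x \in cover M) => //; rewrite addn1.
have yM : y \notin cover M.
  move: (le1 y); rewrite def_m def_m' !mnmDE !mnm1E eqxx mesym1_mem.
  by case: (y \in cover M) => //; rewrite addn1 addnS.
have [mM' kM' cM'] := matching_add mM exy xM yM.
exists ([set x; y] :|: cover M); last by rewrite mesym1_edge -?def_m'.
by apply/matchedP; exists ([set x; y] |: M); rewrite kM' kM.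
Qed.

End Matchings.

(** As [u] is decreasing, the generators before [m] are the larger ones. In the last hypothesis, [p]
    puts the variable of index [v] in the colon ideal of [m], and [m v < m' v] says that this
    variable divides the quotient of [m'] by its gcd with [m]. Hence variables generate the colon
    ideal. *)
Lemma linear_quotients_sorted (K : fieldType) (n d : nat)
    (J : {mpoly K[n]} -> Prop) (u : seq 'X_{1..n}) :
  sorted (>%O : rel 'X_{1..n}) u ->
  ideal_eq J (monomial_ideal (fun m => m \in u)) ->
  (forall m, m \in u -> mdeg m = d) ->
  (forall m m', m \in u -> m' \in u -> (m < m')%O ->
     exists2 v, (m v < m' v)%N &
       exists2 p, p \in u & (m < p)%O && (p <= U_(v) + m)%MM) ->
  has_linear_quotients J.
Proof.
move=> sort_u eqJ deg_u exch; exists u; split.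
- by apply: sorted_uniq sort_u; [exact: (rev_trans lt_trans)|exact: ltxx].
- exact: min_monomial_gens_equigenerated deg_u J eqJ.
move=> i /andP[_ lt_i]; set m := nth _ u i.
have um : m \in u by apply: mem_nth.
have take_uP p : (p \in take i u) = (p \in u) && (m < p)%O.
  have [up|up] /= := boolP (p \in u); last first.
    by apply: contraNF up; apply: mem_take.
  rewrite in_take //; have lt_j : (index p u < size u)%N by rewrite index_mem.
  have homo := sorted_ltn_nth (rev_trans lt_trans) 0%MM sort_u.
  case: ltngtP => [lt_ji|lt_ij|eq_ij].
  - by have := homo _ _ lt_j lt_i lt_ji; rewrite nth_index.
  - have := homo _ _ lt_i lt_j lt_ij; rewrite nth_index //= -/m.
    by move/ltW/le_gtF.
  - by rewrite /m -eq_ij nth_index ?ltxx.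
(* These are exactly the variables that lie in the colon ideal. *)
pose V := [set v | has (fun p => (p <= U_(v) + m)%MM) (take i u)].
exists V => f.
have -> : ideal_gen (fun f => exists2 v, v \in V & f = 'X_v) f <->
    monomial_ideal (fun p => exists2 v, v \in V & p = U_(v)%MM) f.
  split; apply: ideal_gen_sub => g.
    by case=> v Vv ->; apply: ideal_gen_incl; exists U_(v)%MM => //; exists v.
  by case=> _ [v Vv ->] ->; apply: ideal_gen_incl; exists v.
split=> /monomial_idealP fm; apply/monomial_idealP => t.
  move=> ft; have [|m' + le_m'] := fm (m + t)%MM.
    by rewrite (perm_mem (msuppMX _ _)) map_f.
  rewrite take_uP => /andP[um' lt_m'].
  have [v lt_v [p up /andP[lt_p le_p]]] := exch _ _ um um' lt_m'.
  exists U_(v)%MM; first exists v => //.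
    by rewrite inE; apply/hasP; exists p => //; rewrite take_uP up.
  (* Since [m'] divides [m + t], the inequality [m v < m' v <= m v + t v] makes [t v] positive. *)
  rewrite lep1mP -lt0n -(ltn_add2l (m v)) addn0 -mnmDE.
  exact: leq_trans lt_v (mnm_lepP le_m' v).
rewrite (perm_mem (msuppMX _ _)) => /mapP[t' /fm[_ [v Vv ->] le_v] ->].
move: Vv; rewrite inE => /hasP[p up le_p]; exists p => //.
apply: lepm_trans le_p _; rewrite addmC; apply/mnm_lepP => j.
by rewrite !mnmDE leq_add2l (mnm_lepP le_v).
Qed.

Theorem theorem4p1 (K : fieldType) (n : nat) (e : rel 'I_n)
    (e_sym : ssrbool.symmetric e) (e_irr : irreflexive e)
    (e_niso : no_isolated_vertices e) :
  has_linear_quotients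
    (squarefree_power (edge_ideal e K) (matching_number e)).
Proof.
set k := matching_number e.
pose gens := [seq mesym1 U | U <- enum [set U | matched e k U]].
have gensP m : m \in gens <-> squarefree m /\ edge_sum e k m.
  rewrite squarefree_edge_sum //; split.
    by case/mapP=> U; rewrite mem_enum inE => mU ->; exists U.
  by case=> U mU ->; apply: map_f; rewrite mem_enum inE.
apply: (@linear_quotients_sorted K n k.*2 _ (sort >=%O gens)).
(* Sorting gives a weakly decreasing list; it is strictly decreasing because distinct vertex sets
   have distinct monomials. *)
- rewrite -rev_sorted lt_sorted_uniq_le rev_uniq sort_uniq.
  rewrite map_inj_uniq ?enum_uniq /=; last exact: inj_mesym1.
  by rewrite rev_sorted; apply: sort_sorted => x y; apply: le_total.
- have eqM m : mingens (ideal_pow (edge_ideal e K) k) m <-> edge_sum e k m.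
    apply: (mingens_equigenerated (@edge_sum_mdeg n e k)).
    exact: ideal_pow_edge.
  move=> f; split; apply: monomial_ideal_mono => m; rewrite mem_sort.
    by case=> sq_m /eqM km; apply/gensP.
  by case/gensP=> sq_m /eqM.
- by move=> m; rewrite mem_sort => /gensP[_ /edge_sum_mdeg].
move=> m m'; rewrite !mem_sort => um um' lt_m.
(* The order compares degrees first; in equal degree it is decided by the exponents at the first
   index where they differ. *)
have eq_deg : mdeg m = mdeg m'.
  rewrite (edge_sum_mdeg ((gensP m).1 um).2).
  by rewrite (edge_sum_mdeg ((gensP m').1 um').2).
have [v eq_v lt_v] := elimT (ltmcP eq_deg) lt_m; exists v => //.
move: um um' eq_v lt_v => /mapP[U + ->] /mapP[W + ->].
rewrite !mem_enum !inE => mU mW.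
rewrite !mesym1_mem => eq_v.
have [vW|] := boolP (v \in W); have [vU|vU] // := boolP (v \in U); move=> _.
have [a [aU aW mUa]] := matched_exchange e_sym e_irr mU mW vW vU.
(* [U] and [W] agree before [v], whereas [a] lies in [U] only. Trading [a] for the earlier vertex
   [v] therefore increases the monomial. *)
have lt_va : (v < a)%N.
  rewrite ltn_neqAle; apply/andP; split.
    by apply: contraNneq vU => /val_inj ->.
  rewrite leqNgt; apply/negP => /eq_v.
  by rewrite !mesym1_mem aU (negbTE aW).
exists (mesym1 (v |: (U :\ a))).
  by rewrite mem_sort map_f // mem_enum inE.
apply/andP; split; last first.
  apply/mnm_lepP => i; rewrite mnmDE mnm1E !mesym1_mem !inE eq_sym.
  by case: (v == i) => //=; case: (i \in U); rewrite ?andbF // leq_b1.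
apply/ltmcP.
  by rewrite !mdeg_mesym1 cardsU1 !inE (negbTE vU) andbF [LHS](cardsD1 a) aU.
(* An index [j] below [v] is neither [v] nor [a], so the exchange leaves its exponent unchanged. *)
exists v => [j lt_jv|]; rewrite !mesym1_mem !inE ?eqxx ?(negbTE vU) //.
have -> : (j == v) = false by apply/eqP => def_j; rewrite def_j ltnn in lt_jv.
have -> : (j == a) = false; last by [].
by apply/eqP => def_j; rewrite def_j ltnNge ltnW in lt_jv.
Qed.
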